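(* Let $n\ge 2$ be an integer. For every $p = 0,\dots,n$, $(GLSym_n(p), g)$ is isometric to the semi-Riemannian product manifold $(SLSym_n(p) \times \mathbb{R},\ g \times h)$, where $h$ is the Euclidean metric on $\mathbb{R}$.
   Context: $GLSym_n(p)$ ($0\le p\le n$) is the set of non-singular real symmetric $n\times n$ matrices with signature $(p,n-p)$ ($p$ positive and $n-p$ negative eigenvalues), an open subset of the space of real symmetric matrices; $SLSym_n(p)$ is its submanifold of matrices with determinant $(-1)^{n-p}$. The trace metric is $g_A(V,W)=\mathrm{tr}(A^{-1}VA^{-1}W)$ for tangent vectors $V,W$ at $A$; it is a semi-Riemannian metric on both manifolds. An isometry is a diffeomorphism preserving the metric tensors. *)

(* Defs.v *)
From HB Require Import structures.
From mathcomp Require Import all_boot all_order all_algebra.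
From mathcomp Require Import all_classical all_reals all_analysis.

Set Implicit Arguments.
Unset Strict Implicit.
Unset Printing Implicit Defensive.

Import Order.TTheory GRing.Theory Num.Theory.
Import numFieldNormedType.Exports.

Local Open Scope classical_set_scope.
Local Open Scope ring_scope.

(* Manifolds are represented as embedded submanifolds: subsets M of a
   finite-dimensional ambient space, here 'M[R]_n or 'M[R]_n * R.  A metric
   tensor on M is given by g x v w, for x in M and v, w tangent to M at x; its
   values at other arguments play no role. *)

Section SmoothMaps.
Context {R : realType}.

(* On open sets of finite-dimensional spaces this is the usual class C^k:
   all iterated directional derivatives up to order k exist and are
   continuous. *)
Fixpoint Ck_on {E F : normedModType R} (k : nat) (U : set E) (f : E -> F)
    : Prop :=
  match k with
  | 0 => forall x, U x -> {for x, continuous f}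
  | k'.+1 => (forall x, U x -> differentiable f x) /\
             (forall v : E, Ck_on k' U (fun x => 'D_v f x))
  end.

Definition smooth_on {E F : normedModType R} (U : set E) (f : E -> F) : Prop :=
  forall k, Ck_on k U f.

(* Smoothness of a map between embedded submanifolds: f is locally the
   restriction of a smooth map between open sets of the ambient spaces. *)
Definition smooth_map {E F : normedModType R} (M : set E) (N : set F)
    (f : E -> F) : Prop :=
  (forall x, M x -> N (f x)) /\
  (forall x, M x -> exists (U : set E) (f_ext : E -> F),
     [/\ open U, U x, smooth_on U f_ext &
         forall y, M y -> U y -> f_ext y = f y]).

Definition diffeomorphism {E F : normedModType R} (M : set E) (N : set F)
    (f : E -> F) : Prop :=
  smooth_map M N f /\
  exists f_inv : F -> E,
    [/\ smooth_map N M f_inv,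
        forall x, M x -> f_inv (f x) = x &
        forall y, N y -> f (f_inv y) = y].

Definition smooth_curve_at {E : normedModType R} (M : set E) (x : E)
    (c : R -> E) : Prop :=
  c 0 = x /\
  exists I : set R,
    [/\ open I, I 0, smooth_on I c & forall t, I t -> M (c t)].

Definition velocity {E : normedModType R} (c : R -> E) : E := derive1 c 0.

(* The tangent vectors of M at x are the velocities of the smooth curves c of
   M through x, and the differential of f at x sends velocity c to
   velocity (f \o c). *)
Definition preserves_metric {E F : normedModType R} (M : set E)
    (g : E -> E -> E -> R) (h : F -> F -> F -> R) (f : E -> F) : Prop :=
  forall (x : E) (c d : R -> E),
    M x -> smooth_curve_at M x c -> smooth_curve_at M x d ->
    h (f x) (velocity (f \o c)) (velocity (f \o d)) =
    g x (velocity c) (velocity d).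

Definition isometric {E F : normedModType R}
    (M : set E) (g : E -> E -> E -> R)
    (N : set F) (h : F -> F -> F -> R) : Prop :=
  exists f : E -> F, diffeomorphism M N f /\ preserves_metric M g h f.

Definition prod_metric {E F : normedModType R}
    (g : E -> E -> E -> R) (h : F -> F -> F -> R)
    (x v w : (E * F)%type) : R :=
  g x.1 v.1 w.1 + h x.2 v.2 w.2.

Definition euclidean_metric (x v w : R) : R := v * w.

End SmoothMaps.

Section SymmetricMatrices.
Context {R : realType} {n : nat}.

(* Eigenvalues are counted with multiplicity: s lists all of them. *)
Definition has_signature (p q : nat) (A : 'M[R]_n) : Prop :=
  exists s : seq R,
    [/\ char_poly A = \prod_(a <- s) ('X - a%:P),
        count (fun a => 0 < a) s = p &
        count (fun a => a < 0) s = q].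

Definition trace_metric (A V W : 'M[R]_n) : R :=
  \tr (invmx A *m V *m invmx A *m W).

End SymmetricMatrices.

Definition GLSym (R : realType) (n p : nat) : set 'M[R]_n :=
  [set A | [/\ A^T = A, A \in unitmx & has_signature p (n - p) A]].
Arguments GLSym : clear implicits.

Definition SLSym (R : realType) (n p : nat) : set 'M[R]_n :=
  [set A | GLSym R n p A /\ \det A = (-1) ^+ (n - p)].
Arguments SLSym : clear implicits.

(* Main.v *)
From HB Require Import structures.
Require Import Defs.
From mathcomp Require Import all_boot all_order all_algebra.
From mathcomp Require Import all_classical all_reals all_analysis.
From mathcomp Require Import ring.

Set Implicit Arguments.
Unset Strict Implicit.
Unset Printing Implicit Defensive.

Import Order.TTheory GRing.Theory Num.Theory.
Import numFieldNormedType.Exports.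
Local Open Scope classical_set_scope.
Local Open Scope ring_scope.

(** A nondegenerate symmetric matrix is a positive multiple of one with
    determinant of absolute value 1, and the isometry separates the multiple
    from the normalized matrix: put [s = ln |det A| / n] and send [A] to
    [(exp (- s) A, sqrt n * s)], with inverse [(B, t) |-> exp (t / sqrt n) B].
    Multiplying by a positive number multiplies each eigenvalue by it, so the
    signature is kept ([has_signatureZ]); a matrix with [q] negative
    eigenvalues has determinant of sign [(-1) ^ q] ([det_has_signature]), so
    [|det A| = (-1) ^ q * det A] is a polynomial in the entries.

    Jacobi's formula ([is_diff_det]) gives [ds (V) = tr (A^-1 V) / n].  Hence
    the first component of the differential is [exp (- s) (V - ds (V) A)],
    which amounts to replacing [X = A^-1 V] by its trace-free part
    [X - (tr X / n) I].  The decomposition of matrices into trace-free part and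
    multiple of the identity is orthogonal for [tr (X Y)], and the identity has
    square [n]; so the trace metric is the sum of its value on the trace-free
    parts and [n ds (V) ds (W)] ([trace_metric_trace_free]), and the factor
    [sqrt n] turns the second summand into the Euclidean metric on the line.

    Smoothness of the two maps comes from stability properties of the classes
    C^k.  Each of them is an induction on [k] through [Ck_onS]: it is
    enough to exhibit a differential whose value on each fixed vector is C^k in
    the base point. *)

(** * Maps of class C^k *)

(** Lets a map be replaced by another that agrees with it only locally, as
    happens with the formulas for derivatives, which hold on an open set. *)
Lemma near_eq_is_diff {R : numFieldType} {V W : normedModType R}
    (f g : V -> W) (x : V) (df : V -> W) :
  (\near x, f x = g x) -> is_diff x f df -> is_diff x g df.
Proof.
move=> fg [dfx <-].
have [dfc /eqaddoP dfo] := (diff_locallyP _ _).1 dfx.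
have dgo : g \o shift x = cst (g x) + 'd f x +o_ 0 id.
  apply/eqaddoE/eqaddoP => e e0; move: (fg) (dfo e e0).
  rewrite (near_shift 0) subr0 => fg0; apply: filterS2 fg0 => h /= fgh.
  by rewrite !fctE /= fgh (nbhs_singleton fg).
have dg : 'd g x = 'd f x :> (V -> W) by exact: diff_unique.
by apply: DiffDef => //; apply/diff_locallyP; rewrite dg.
Qed.

Section CkCalculus.
Context {R : realType}.
Implicit Types E F : normedModType R.

Lemma Ck_on_eq {E F} k (U : set E) (f g : E -> F) : open U ->
  (forall x, U x -> f x = g x) -> Ck_on k U f -> Ck_on k U g.
Proof.
move=> oU; elim: k f g => [|k IHk] f g fg /=.
  move=> fc x Ux; have fgx : \near x, f x = g x.
    by apply: filterS (open_nbhs_nbhs (conj oU Ux)).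
  suff : g @ x --> f x by rewrite (fg x Ux).
  exact: cvg_trans (near_eq_cvg fgx) (fc x Ux).
case=> fd fD.
have fgn x : U x -> \near x, f x = g x.
  by move=> Ux; apply: filterS (open_nbhs_nbhs (conj oU Ux)).
split=> [x Ux|v].
  by have [] := near_eq_is_diff (fgn x Ux) (differentiableP (fd x Ux)).
apply: IHk (fD v) => x Ux; exact: near_eq_derive (fgn x Ux).
Qed.

(** The induction step of all the stability results: the derivatives of [f]
    need only be known on [U], where they are given by a formula [df]. *)
Lemma Ck_onS {E F} k (U : set E) (f : E -> F) (df : E -> E -> F) :
  open U -> (forall x, U x -> is_diff x f (df x)) ->
  (forall v, Ck_on k U (df ^~ v)) -> Ck_on k.+1 U f.
Proof.
move=> oU fdf dfk; split=> [x /fdf[]//|v]; apply: Ck_on_eq (dfk v) => // x Ux.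
by have [fd <-] := fdf x Ux; rewrite deriveE.
Qed.

Lemma Ck_onW {E F} k (U : set E) (f : E -> F) : Ck_on k.+1 U f -> Ck_on k U f.
Proof.
elim: k f => [|k IHk] f [fd fD].
  by move=> x /fd; exact: differentiable_continuous.
by split=> // v; apply: IHk; exact: fD.
Qed.

Lemma is_diff_Ck_on {E F} k (U : set E) (f : E -> F) x :
  Ck_on k.+1 U f -> U x -> is_diff x f (fun v => 'D_v f x).
Proof.
move=> [fd _] Ux; apply: DiffDef; first exact: fd.
by apply/funext => v; rewrite deriveE //; exact: fd.
Qed.

Lemma Ck_on_cst {E F} k (U : set E) (a : F) : open U -> Ck_on k U (cst a).
Proof.
move=> oU; elim: k a => [|k IHk] a; first by move=> x _; exact: cvg_cst.
by apply: (@Ck_onS E F k _ _ (fun=> cst 0)) => // v; exact: IHk.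
Qed.

Lemma Ck_on_lin {E F} k (U : set E) (f : {linear E -> F}) : open U ->
  continuous f -> Ck_on k U f.
Proof.
move=> oU fc; case: k => [|k]; first by move=> x _; exact: fc.
apply: (@Ck_onS _ _ k _ _ (fun=> f)) => // [x _|v];
  last exact: Ck_on_cst.
by apply: DiffDef; [exact: linear_differentiable | exact: diff_lin].
Qed.

Lemma Ck_onD {E F} k (U : set E) (f g : E -> F) : open U ->
  Ck_on k U f -> Ck_on k U g -> Ck_on k U (fun x => f x + g x).
Proof.
move=> oU; elim: k f g => [|k IHk] f g fk gk.
  by move=> x Ux; apply: cvgD; [exact: fk|exact: gk].
apply: (@Ck_onS _ _ k _ _ (fun x v => 'D_v f x + 'D_v g x))
  => // [x Ux|v].
  have df := is_diff_Ck_on fk Ux.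
  have dg := is_diff_Ck_on gk Ux.
  exact: is_diffD.
by apply: IHk; [exact: fk.2 | exact: gk.2].
Qed.

Lemma Ck_on_pair {E F G : normedModType R} k (U : set E) (f : E -> F)
    (g : E -> G) :
  open U -> Ck_on k U f -> Ck_on k U g -> Ck_on k U (fun x => (f x, g x)).
Proof.
move=> oU; elim: k f g => [|k IHk] f g fk gk.
  by move=> x Ux; apply: cvg_pair; [exact: fk|exact: gk].
apply: (@Ck_onS _ _ k _ _ (fun x v => ('D_v f x, 'D_v g x)))
  => // [x Ux|v].
  have df := is_diff_Ck_on fk Ux.
  have dg := is_diff_Ck_on gk Ux.
  exact: is_diff_pair.
by apply: IHk; [exact: fk.2 | exact: gk.2].
Qed.

(** The product rule, as the differential of the continuous bilinear map
    [(a, y) |-> a *: y] composed with [(k, f)]. *)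
Lemma is_diff_scale {E F} (k dk : E -> R) (f df : E -> F) x :
  is_diff x k dk -> is_diff x f df ->
  is_diff x (fun y => k y *: f y) (fun v => k x *: df v + dk v *: f x).
Proof.
move=> dkx dfx.
have scale_bil : bilinear_for
    (GRing.Scale.Law.clone _ _ *:%R _) (GRing.Scale.Law.clone _ _ *:%R _)
    (@GRing.scale R F : R -> F -> F).
  by split=> [u'|u] a y z /=; [rewrite scalerDl -scalerA|
    rewrite scalerDr !scalerA mulrC].
pose bM := bilinear_isBilinear.Build R R F F _ _ _ scale_bil.
pose b : {bilinear R -> F -> F} := HB.pack (@GRing.scale R F : R -> F -> F) bM.
have bc : continuous (fun p : R * F => b p.1 p.2) by exact: scale_continuous.
have bd : is_diff (k x, f x) (fun p : R * F => b p.1 p.2)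
    (fun q => k x *: q.2 + q.1 *: f x).
  by apply: DiffDef; [exact: differentiable_bilin | exact: diff_bilin].
exact: (@is_diff_comp _ _ _ _ (fun y => (k y, f y)) _ _ _ x _ bd).
Qed.

Lemma Ck_onZ {E F} n (U : set E) (k : E -> R) (f : E -> F) : open U ->
  Ck_on n U k -> Ck_on n U f -> Ck_on n U (fun x => k x *: f x).
Proof.
move=> oU; elim: n k f => [|n IHn] k f kk fk.
  by move=> x Ux; apply: (cvgZ (kk x Ux) (fk x Ux)).
apply: (@Ck_onS _ _ n _ _ (fun x v => k x *: 'D_v f x + 'D_v k x *: f x))
  => // [x Ux|v].
  by apply: is_diff_scale (is_diff_Ck_on kk Ux) (is_diff_Ck_on fk Ux).
apply: Ck_onD => //; apply: IHn; first exact: Ck_onW.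
- exact: fk.2.
- exact: kk.2.
- exact: Ck_onW.
Qed.

(** A single real intermediate variable suffices here, and keeps the chain rule
    in the form of a scalar times a vector, [f' (x) v *: g' (f x)], to which
    [Ck_onZ] applies. *)
Lemma Ck_on_comp {E F} k (U : set E) (V : set R) (f : E -> R) (g : R -> F) :
  open U -> (forall x, U x -> V (f x)) ->
  Ck_on k V g -> Ck_on k U f -> Ck_on k U (fun x => g (f x)).
Proof.
move=> oU UV; elim: k g => [|k IHk] g gk fk.
  move=> x Ux; apply: continuous_comp; first exact: fk.
  by apply: gk; exact: UV.
apply: (@Ck_onS _ _ k _ _ (fun x v => 'D_v f x *: 'D_1 g (f x)))
  => // [x Ux|v].
  have df := is_diff_Ck_on fk Ux.
  have dg := is_diff_Ck_on gk (UV _ Ux).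
  rewrite [X in is_diff_def _ _ X](_ : _ =
    (fun h => 'D_h g (f x)) \o (fun v => 'D_v f x)).
    exact: is_diff_comp.
  apply/funext => v /=; case: gk => /(_ _ (UV _ Ux)) gd _; rewrite !deriveE //.
  by rewrite -linearZ /= [_%:A]mulr1.
apply: Ck_onZ => //; first exact: fk.2.
by exact: IHk (gk.2 1) (Ck_onW fk).
Qed.

Lemma Ck_on_sum {E F} {I : Type} k (U : set E) (r : seq I)
    (f : I -> E -> F) :
  open U -> (forall i, Ck_on k U (f i)) ->
  Ck_on k U (fun x => \sum_(i <- r) f i x).
Proof.
move=> oU fk; elim: r => [|i r IHr].
  by apply: Ck_on_eq (@Ck_on_cst _ _ k U 0 oU) => // x _; rewrite big_nil.
by apply: Ck_on_eq (Ck_onD oU (fk i) IHr) => // x _; rewrite big_cons.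
Qed.

Lemma Ck_on_prod {E} {I : Type} k (U : set E) (r : seq I)
    (f : I -> E -> R) :
  open U -> (forall i, Ck_on k U (f i)) ->
  Ck_on k U (fun x => \prod_(i <- r) f i x).
Proof.
move=> oU fk; elim: r => [|i r IHr].
  by apply: Ck_on_eq (@Ck_on_cst E R k U 1 oU) => // x _; rewrite big_nil.
by apply: Ck_on_eq (Ck_onZ oU (fk i) IHr) => // x _; rewrite big_cons.
Qed.

Lemma is_derive1_diff {F} (f : R -> F) (x : R) (df : F) :
  is_derive x 1 f df -> is_diff x f ( *:%R^~ df).
Proof.
move=> [fd <-]; apply: DiffDef; first exact/derivable1_diffP.
by rewrite deriv1E // derive1E.
Qed.

(** The exponential is its own derivative, so class C^k of the derivative is
    the induction hypothesis. *)
Lemma Ck_on_expR k : Ck_on k setT (@expR R).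
Proof.
elim: k => [|k IHk]; first by move=> x _; exact: continuous_expR.
apply: (@Ck_onS R R k _ _ (fun x v => v *: expR x)).
- exact: openT.
- by move=> x _; exact: (@is_derive1_diff R expR x _ (is_derive_expR x)).
- by move=> v; exact: Ck_onZ openT (Ck_on_cst k v openT) IHk.
Qed.

(** The derivative of the inverse is a polynomial in the inverse. *)
Lemma Ck_on_inv k : Ck_on k [set x : R | 0 < x] GRing.inv.
Proof.
have oP : open [set x : R | 0 < x] by exact: open_gt.
elim: k => [|k IHk].
  by move=> x /= x0; apply: continuousV => //; exact: lt0r_neq0.
apply: (@Ck_onS R R k _ _ (fun x v => - v *: (x^-1 *: x^-1)))
  => // [x /= x0|v].
  have xn0 := lt0r_neq0 x0; apply: DiffDef; first exact: differentiable_Rinv.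
  rewrite diff_Rinv //; apply/funext => v.
  by rewrite /GRing.scale /= -exprVn expr2 !mulNr [v * _]mulrC.
by apply: Ck_onZ => //; [exact: Ck_on_cst | exact: Ck_onZ].
Qed.

Lemma Ck_on_ln k : Ck_on k [set x : R | 0 < x] (@ln R).
Proof.
have oP : open [set x : R | 0 < x] by exact: open_gt.
case: k => [|k]; first by move=> x x0; exact: continuous_ln.
apply: (@Ck_onS R R k _ _ (fun x v => v *: x^-1)) => // [x x0|v].
  exact: (@is_derive1_diff R (@ln R) x _ (is_derive1_ln x0)).
by apply: Ck_onZ => //; [exact: Ck_on_cst | exact: Ck_on_inv].
Qed.

Lemma Ck_on_coord {m n} k (U : set 'M[R]_(m, n)) i j : open U ->
  Ck_on k U (fun A => A i j).
Proof.
move=> oU; have coord_lin : linear (fun A : 'M[R]_(m, n) => A i j).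
  by move=> a A B; rewrite !mxE.
pose cM := GRing.isLinear.Build _ _ _ _ _ coord_lin.
pose c : {linear 'M[R]_(m, n) -> R} :=
  HB.pack (fun A : 'M[R]_(m, n) => A i j) cM.
apply: (@Ck_on_lin _ _ _ _ c) => //; exact: coord_continuous.
Qed.

(** Leibniz's formula makes the determinant a polynomial in the entries. *)
Lemma Ck_on_det {n} k (U : set 'M[R]_n) : open U -> Ck_on k U determinant.
Proof.
move=> oU; apply: Ck_on_sum => // s; apply: Ck_onZ => //.
  exact: Ck_on_cst.
by apply: Ck_on_prod => // i; exact: Ck_on_coord.
Qed.

End CkCalculus.

(** * The differential of the determinant *)

(** Only row [i] changes, so the cofactors along it do not: the determinant is
    affine in each entry. *)
Lemma det_add_delta {R : comNzRingType} {n} (A : 'M[R]_n) (i j : 'I_n) (t : R) :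
  \det (A + t *: delta_mx i j) = \det A + t * cofactor A i j.
Proof.
have cofE k : cofactor (A + t *: delta_mx i j) i k = cofactor A i k.
  congr (_ * \det _); apply/matrixP => a b.
  by rewrite !mxE eq_sym (negbTE (neq_lift _ _)) mulr0 addr0.
rewrite !(expand_det_row _ i).
under eq_bigr do rewrite cofE !mxE eqxx mulrDl /=.
rewrite big_split /=; congr (_ + _).
rewrite (bigD1 j) //= eqxx mulr1 big1 ?addr0 // => k /negbTE ->.
by rewrite mulr0 mul0r.
Qed.

(** Jacobi's formula.  The differential is linear, so it is enough to compute
    it on the elementary matrices, along which the determinant is affine. *)
Lemma is_diff_det {R : realType} {n} (A : 'M[R]_n) :
  is_diff A (@determinant R n) (fun V => \tr (\adj A *m V)).
Proof.
have detd : differentiable (@determinant R n) A.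
  by have [+ _] := @Ck_on_det R n 1 setT openT; apply.
apply: DiffDef => //; apply/funext => V; rewrite {1}[V]matrix_sum_delta.
rewrite linear_sum mxtrace_mulC /mxtrace; apply: eq_bigr => i _.
rewrite linear_sum mxE; apply: eq_bigr => j _.
rewrite linearZ /= mxE /GRing.scale /=; congr (_ * _).
rewrite -deriveE //.
pose c := cofactor A i j.
have [_] : is_derive (0 : R) (1 : R) (cst (\det A) + c *: (@id R)) (0 + c *: 1).
  exact: is_deriveD.
rewrite add0r [_ *: 1]mulr1 /c => <-.
rewrite /derive; set q := (fun h : R => h^-1 *: _).
set r := (fun h : R => h^-1 *: _).
suff -> : q = r by [].
apply/funext => h; rewrite /q /r /= !fctE /= addr0 [_%:A]mulr1 [_ + A]addrC.
by rewrite det_add_delta [_ *: h]mulrC [_ *: 0]mulr0 addr0.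
Qed.

(** * Signature and determinant *)

(** [X - c A = c (X / c - A)], and substituting [X / c] for [X]
    commutes with the determinant. *)
Lemma char_polyZ {F : fieldType} {n} (c : F) (A : 'M[F]_n) : c != 0 ->
  char_poly (c *: A) = c ^+ n *: (char_poly A \Po (c^-1 *: 'X)).
Proof.
move=> c0; rewrite /char_poly -[X in _ = _ *: X]/(comp_poly _ _) -det_map_mx.
rewrite -mul_polyC polyC_exp -detZ; congr (\det _); apply/matrixP => i j.
rewrite !mxE rmorphB rmorphMn /= comp_polyX comp_polyC mulrBr polyCM mulrnAr.
by rewrite [c%:P * (_ *: _)]mul_polyC scalerA divff // scale1r.
Qed.

Lemma has_signatureZ {R : realType} {n} p q (c : R) (A : 'M[R]_n) : 0 < c ->
  has_signature p q A -> has_signature p q (c *: A).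
Proof.
move=> c0 [s [sA sp sq]]; exists [seq c * a | a <- s].
have ss : size s = n.
  have := size_char_poly A; rewrite sA size_prod_XsubC; by case.
split.
- rewrite char_polyZ ?gt_eqF // sA big_map -ss -[X in _ *: X]/(comp_poly _ _).
  have -> : c ^+ size s = \prod_(a <- s) c.
    by rewrite big_const_seq count_predT iter_mulr mulr1.
  rewrite -mul_polyC !rmorph_prod /= -big_split /=.
  apply: eq_bigr => a _; rewrite rmorphB /= comp_polyX comp_polyC mulrBr.
  by rewrite mul_polyC scalerA divff ?gt_eqF // scale1r polyCM.
- by rewrite count_map -sp; apply: eq_count => a /=; rewrite pmulr_rgt0.
- by rewrite count_map -sq; apply: eq_count => a /=; rewrite pmulr_rlt0.
Qed.

Lemma prodr_sign_gt0 {R : realDomainType} (s : seq R) :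
  \prod_(a <- s) a != 0 ->
  0 < (-1) ^+ count (fun a => a < 0) s * \prod_(a <- s) a.
Proof.
elim: s => [|a s IHs]; first by rewrite !big_nil mul1r ltr01.
rewrite big_cons mulf_eq0 negb_or => /andP[a0 /IHs s0] /=.
have [an|ap] := ltP a 0.
  by rewrite add1n exprS mulN1r mulNr mulrCA -mulNr pmulr_lgt0 // oppr_gt0.
by rewrite add0n mulrCA pmulr_rgt0 // lt0r a0.
Qed.

(** The determinant is the product of the eigenvalues, hence its sign counts
    the negative ones. *)
Lemma det_has_signature {R : realType} {n} p q (A : 'M[R]_n) :
  A \in unitmx -> has_signature p q A -> 0 < (-1) ^+ q * \det A.
Proof.
move=> uA [s [sA _ <-]].
have ss : size s = n.
  have := size_char_poly A; rewrite sA size_prod_XsubC; by case.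
have detA : \det A = \prod_(a <- s) a.
  have := char_poly_det A; rewrite sA -horner_coef0 horner_prod.
  rewrite (eq_bigr (fun a => - 1 * a)) => [|a _];
    last by rewrite hornerXsubC sub0r mulN1r.
  rewrite big_split /= big_const_seq count_predT iter_mulr mulr1 ss.
  by move=> /esym /(mulfI _) ->; rewrite ?signr_eq0.
rewrite detA.
by apply: prodr_sign_gt0; rewrite -detA -unitfE -unitmxE.
Qed.

(** * The splitting and its differential *)

(** Reduces the comparison of metrics on velocities of curves to the
    differential of the map. *)
Lemma velocity_comp {R : realType} {E F : normedModType R} (M : set E) (x : E)
    (c : R -> E) (f df : E -> F) :
  smooth_curve_at M x c -> is_diff x f df ->
  velocity (f \o c) = df (velocity c).
Proof.
move=> [c0 [I [_ I0 cI _]]] fdf.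
have cd : differentiable c 0 by exact: (cI 1).1.
rewrite -c0 in fdf; have [fd <-] := fdf.
rewrite /velocity (derive1E' cd) (derive1E' (differentiable_comp cd fd)).
by rewrite (diff_comp cd fd).
Qed.

(** The orthogonal decomposition of the metric: [a] and [b] are the coefficients
    of the identity in [A^-1 V] and [A^-1 W].  The common factor [e] disappears
    because the metric is invariant under homotheties. *)
Lemma trace_metric_trace_free {F : realType} {n} (A V W : 'M[F]_n) (e : F) :
  (0 < n)%N -> A \in unitmx -> e != 0 ->
  let a := \tr (invmx A *m V) / n%:R in
  let b := \tr (invmx A *m W) / n%:R in
  trace_metric (e *: A) (e *: (V - a *: A)) (e *: (W - b *: A)) + n%:R * a * b
  = trace_metric A V W.
Proof.
move=> n_gt0 uA e0 a b.
have n_neq0 : n%:R != 0 :> F by rewrite pnatr_eq0 -lt0n.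
have mxtraceB (X Y : 'M[F]_n) : \tr (X - Y) = \tr X - \tr Y by exact: raddfB.
have ue : e *: A \in unitmx by rewrite unitmxZ // unitfE.
have inv_mul U c : invmx (e *: A) *m (e *: (U - c *: A)) = invmx A *m U - c%:M.
  rewrite invmxZ // -scalemxAr -scalemxAl scalerA divff // scale1r.
  by rewrite mulmxBr -scalemxAr mulVmx // scalemx1.
rewrite /trace_metric -[X in \tr X + _]mulmxA !inv_mul -[X in _ = \tr X]mulmxA.
rewrite mulmxBl !mulmxBr !mxtraceB mul_mx_scalar !mul_scalar_mx.
rewrite !linearZ /= mxtrace_scalar.
have -> : \tr (invmx A *m V) = a * n%:R by rewrite divfK.
have -> : \tr (invmx A *m W) = b * n%:R by rewrite divfK.
rewrite /GRing.scale /=; ring.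
Qed.

Section Splitting.
Context {R : realType} {n : nat} (q : nat).
Implicit Types A V W : 'M[R]_n.

(** The sign [(-1) ^+ q] stands for an absolute value: it is the sign of the
    determinant in presence of [q] negative eigenvalues.  Up to the factor
    [n], this is the logarithm of [|det A|], so that [expR (log_scale A)] is
    the [n]-th root of [|det A|]. *)
Definition log_scale A : R := ln ((-1) ^+ q * \det A) / n%:R.

(** The factor [sqrt n] is the length of the identity for the form
    [tr (X Y)]; it makes the second coordinate an arc length. *)
Definition split_scale A : 'M[R]_n * R :=
  (expR (- log_scale A) *: A, Num.sqrt n%:R * log_scale A).

Definition merge_scale (Bt : 'M[R]_n * R) : 'M[R]_n :=
  expR (Bt.2 / Num.sqrt n%:R) *: Bt.1.

Lemma is_diff_log_scale A : 0 < (-1) ^+ q * \det A ->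
  is_diff A log_scale (fun V => \tr (invmx A *m V) / n%:R).
Proof.
move=> Apos; have dA : \det A != 0.
  by apply: contraTneq Apos => ->; rewrite mulr0 ltxx.
have lnd := is_derive1_diff (is_derive1_ln Apos).
have d1 : is_diff A (fun B => (-1) ^+ q * \det B)
    (fun V => (-1) ^+ q * \tr (\adj A *m V)).
  exact: (is_diffZ ((-1) ^+ q) (is_diff_det A)).
have d2 := is_diff_comp d1 lnd.
have d3 := is_diffZ (n%:R^-1) d2.
rewrite [X in is_diff_def _ X _](_ : _ =
    n%:R^-1 \*: (@ln R \o fun B => (-1) ^+ q * \det B)); last first.
  by apply/funext => B; rewrite /log_scale mulrC.
apply: is_diff_eq d3 _; apply/funext => V /=.
rewrite /invmx unitmxE unitfE dA -scalemxAl mxtraceZ.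
rewrite !fctE /GRing.scale /= mulrC; congr (_ / _).
by rewrite invfM mulrACA divff ?signr_eq0 // mul1r mulrC.
Qed.

Lemma is_diff_split_scale A : 0 < (-1) ^+ q * \det A ->
  is_diff A split_scale (fun V =>
    let s' := \tr (invmx A *m V) / n%:R in
    (expR (- log_scale A) *: (V - s' *: A), Num.sqrt n%:R * s')).
Proof.
move=> Apos; have ds := is_diff_log_scale Apos.
have de : is_diff A (fun B => expR (- log_scale B))
    (fun V => - (\tr (invmx A *m V) / n%:R) * expR (- log_scale A)).
  exact: (is_diff_comp (is_diffN ds) (is_derive1_diff (is_derive_expR _))).
have dB := is_diff_scale de (is_diff_id A).
have dt := is_diffZ (Num.sqrt n%:R) ds.
apply: is_diff_eq (is_diff_pair dB dt) _.
apply/funext => V /=; congr (_, _).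
by rewrite scalerBr scalerA mulNr scaleNr mulrC.
Qed.

End Splitting.

(** * Smoothness of the splitting *)

Section SmoothSplitting.
Context {R : realType} {n : nat} (q : nat).

Lemma Ck_on_signed_det k (U : set 'M[R]_n) : open U ->
  Ck_on k U (fun A => (-1) ^+ q * \det A).
Proof.
move=> oU; apply: (@Ck_onZ R 'M[R]_n R k U _ _ oU); first exact: Ck_on_cst.
exact: Ck_on_det.
Qed.

Lemma open_signed_det_gt0 : open [set A : 'M[R]_n | 0 < (-1) ^+ q * \det A].
Proof.
have dc : continuous (fun A : 'M[R]_n => (-1) ^+ q * \det A).
  by move=> A; exact: (Ck_on_signed_det 0 openT).
by have := (continuousP _).1 dc _ (@open_gt R 0).
Qed.

Lemma smooth_split_scale :
  smooth_on [set A : 'M[R]_n | 0 < (-1) ^+ q * \det A] (split_scale q).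
Proof.
move=> k; set U := [set A | _]; have oU : open U := open_signed_det_gt0.
have logk : Ck_on k U (log_scale q).
  apply: (@Ck_onZ R 'M[R]_n R k U _ (cst n%:R^-1) oU); last exact: Ck_on_cst.
  by apply: (Ck_on_comp oU _ (Ck_on_ln k) (Ck_on_signed_det k oU)) => A.
have nlogk : Ck_on k U (fun A => - log_scale q A).
  apply: (@Ck_on_eq R 'M[R]_n R k U (fun A => -1 * log_scale q A) _ oU).
    by move=> A _; rewrite mulN1r.
  exact: (@Ck_onZ R 'M[R]_n R k U _ _ oU (@Ck_on_cst R _ R k U (-1) oU) logk).
apply: (Ck_on_pair oU (Ck_onZ oU _ _)).
- exact: (Ck_on_comp oU _ (Ck_on_expR k) nlogk).
- by apply: (@Ck_on_lin R _ _ k U idfun oU) => A.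
- exact: (@Ck_onZ R 'M[R]_n R k U _ _ oU (Ck_on_cst k _ oU) logk).
Qed.

Lemma smooth_merge_scale : smooth_on setT (@merge_scale R n).
Proof.
move=> k; apply: (Ck_onZ openT).
  apply: (Ck_on_comp openT _ (Ck_on_expR k)) => //.
  apply: (@Ck_onZ R ('M[R]_n * R)%type R k setT _ (cst _) openT);
    last exact: Ck_on_cst openT.
  by apply: (@Ck_on_lin R _ _ k setT snd openT) => A; exact: cvg_snd.
by apply: (@Ck_on_lin R _ _ k setT fst openT) => A; exact: cvg_fst.
Qed.

End SmoothSplitting.

(** * Matrices of fixed signature *)

Lemma GLSym_signed_det_gt0 {R : realType} n p (A : 'M[R]_n) :
  GLSym R n p A -> 0 < (-1) ^+ (n - p) * \det A.
Proof. by case=> _ uA sA; exact: det_has_signature sA. Qed.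

Lemma GLSymZ {R : realType} n p (c : R) (A : 'M[R]_n) : 0 < c ->
  GLSym R n p A -> GLSym R n p (c *: A).
Proof.
move=> c0 [sA uA gA]; split; first by rewrite linearZ /= sA.
  by rewrite unitmxZ // unitfE gt_eqF.
exact: has_signatureZ.
Qed.

Theorem proposition2p6 (R : realType) (n p : nat)
    (hn : (2 <= n)%N) (hp : (p <= n)%N) :
  isometric (GLSym R n p) trace_metric
            (SLSym R n p `*` [set: R]) (prod_metric trace_metric euclidean_metric).
Proof.
have n_gt0 : (0 < n)%N by exact: leq_trans hn.
have n_neq0 : n%:R != 0 :> R by rewrite pnatr_eq0 -lt0n.
have sqrtn_neq0 : Num.sqrt n%:R != 0 :> R by rewrite sqrtr_eq0 -ltNge ltr0n.
pose q := (n - p)%N.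
exists (split_scale q); split; last first.
  move=> A c d /[dup] MA /GLSym_signed_det_gt0 Apos cA dA.
  have df := is_diff_split_scale Apos.
  rewrite (velocity_comp cA df) (velocity_comp dA df).
  case: MA => _ uA _.
  have e0 : expR (- log_scale q A) != 0 by rewrite gt_eqF // expR_gt0.
  rewrite -(trace_metric_trace_free _ _ n_gt0 uA e0) /prod_metric /=.
  congr (_ + _).
  by rewrite /euclidean_metric mulrACA -expr2 sqr_sqrtr // mulrA.
split; [split|exists merge_scale; split; [split| |]].
- move=> A MA; have Apos := GLSym_signed_det_gt0 MA; split=> //=; split.
    by apply: GLSymZ => //; exact: expR_gt0.
  rewrite detZ -expRM_natr mulNr divfK // expRN lnK ?posrE //.
  have dA : \det A != 0 by apply: contraTneq Apos => ->; rewrite mulr0 ltxx.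
  by rewrite invfM mulfVK // invr_sign.
- move=> A /GLSym_signed_det_gt0 Apos.
  exists [set B : 'M[R]_n | 0 < (-1) ^+ q * \det B], (split_scale q).
  by split; [exact: open_signed_det_gt0 | | exact: smooth_split_scale |].
- by move=> [B t] [[MB _] _] /=; apply: GLSymZ => //; exact: expR_gt0.
- move=> Bt _; exists setT, merge_scale.
  by split; [exact: openT | | exact: smooth_merge_scale |].
- move=> A _; rewrite /merge_scale /= scalerA [Num.sqrt _ * _]mulrC mulfK //.
  by rewrite -expRD subrr expR0 scale1r.
- move=> [B t] [[MB dB] _] /=; rewrite /merge_scale /=.
  set s := t / Num.sqrt n%:R.
  have logE : log_scale q (expR s *: B) = s.
    rewrite /log_scale detZ dB mulrCA -expr2 sqrr_sign mulr1 -expRM_natr expRK.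
    by rewrite mulfK.
  rewrite /split_scale logE scalerA -expRD addNr expR0 scale1r.
  by rewrite /s mulrC divfK.
Qed.
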